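(* Let $G_1$ and $G_2$ be commutative multiplicative hyperrings with nonzero identity. Let $A=A_1\times A_2$ where $A_1$ and $A_2$ are $\mathcal{C}$-hyperideals of $G_1$ and $G_2$, respectively, and let $S=S_1\times S_2$ where $S_1$ and $S_2$ are multiplicative closed subsets of $G_1$ and $G_2$, respectively. Then the following conditions are equivalent. (i) $A$ is a quasi $S$-primary hyperideal of $G=G_1\times G_2$. (ii) $S_1\cap A_1\neq\varnothing$ and $A_2$ is a quasi $S_2$-primary hyperideal of $G_2$, or $S_2\cap A_2\neq\varnothing$ and $A_1$ is a quasi $S_1$-primary hyperideal of $G_1$.
   Context: A commutative multiplicative hyperring with identity is a triple $(G,+,\circ)$ where $(G,+)$ is an abelian group and $\circ$ assigns to each pair $(x,y)\in G\times G$ a non-empty subset $x\circ y\subseteq G$, such that for all $x,y,z\in G$: $(x\circ y)\circ z=x\circ(y\circ z)$; $(-x)\circ y=x\circ(-y)=-(x\circ y)$; $(y+z)\circ x\subseteq y\circ x+z\circ x$ and $x\circ(y+z)\subseteq x\circ y+x\circ z$; $x\circ y=y\circ x$; and there is $1\in G$ with $a\in 1\circ a$ for all $a\in G$. For non-empty subsets $X,Y\subseteq G$, $X\circ Y=\bigcup_{x\in X,y\in Y}x\circ y$ and $X+Y=\{x+y: x\in X,y\in Y\}$; elements are identified with singletons. A hyperideal of $G$ is a non-empty $A\subseteq G$ with $x-y\in A$ for all $x,y\in A$ and $r\circ x\subseteq A$ for all $x\in A$, $r\in G$. A proper hyperideal $P$ is prime if $x\circ y\subseteq P$ ($x,y\in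 G$) implies $x\in P$ or $y\in P$. $\mathrm{rad}(A)$ is the intersection of all prime hyperideals containing $A$, and $\mathrm{rad}(A)=G$ if there are none. $A$ is a $\mathcal{C}$-hyperideal if for all $n\in\mathbb{N}$ and $a_1,\dots,a_n\in G$, $(a_1\circ\cdots\circ a_n)\cap A\neq\varnothing$ implies $a_1\circ\cdots\circ a_n\subseteq A$. A multiplicative closed subset (MCS) of $G$ is a subset $S\subseteq G$ containing $1$ with $(s_1\circ s_2)\cap S\neq\varnothing$ for all $s_1,s_2\in S$. A hyperideal $A$ with $A\cap S=\varnothing$ is quasi $S$-primary if there is $t\in S$ such that for all $u,v\in G$, $u\circ v\subseteq A$ implies $t\circ u\subseteq \mathrm{rad}(A)$ or $t\circ v\subseteq\mathrm{rad}(A)$. For multiplicative hyperrings $(G_1,+_1,\circ_1)$ and $(G_2,+_2,\circ_2)$ with nonzero identity, $G_1\times G_2$ is the multiplicative hyperring with componentwise addition and $(u_1,u_2)\circ(v_1,v_2)=\{(u,v): u\in u_1\circ_1v_1,\ v\in u_2\circ_2v_2\}$. *)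

(* Defs.v *)
From HB Require Import structures.
From mathcomp Require Import all_boot all_algebra.
From mathcomp Require Import boolp classical_sets.

Set Implicit Arguments.
Unset Strict Implicit.
Unset Printing Implicit Defensive.

Import GRing.Theory.
Local Open Scope classical_set_scope.
Local Open Scope ring_scope.

Definition lift_hop (T : Type) (op : T -> T -> set T) (X Y : set T) : set T :=
  \bigcup_(x in X) \bigcup_(y in Y) op x y.

Definition set_add (V : zmodType) (X Y : set V) : set V :=
  [set x + y | x in X & y in Y].

Definition set_opp (V : zmodType) (X : set V) : set V :=
  [set - x | x in X].

HB.mixin Record Zmodule_isComMultHyperring G of GRing.Zmodule G := {
  hone : G;
  hmul : G -> G -> set G;
  hmul_neq0 : forall x y, hmul x y !=set0;
  hmulA : forall x y z,
    lift_hop hmul (hmul x y) [set z] = lift_hop hmul [set x] (hmul y z);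
  hmulNl : forall x y, hmul (- x) y = set_opp (hmul x y);
  hmulNr : forall x y, hmul x (- y) = set_opp (hmul x y);
  hmulDl : forall x y z, hmul (y + z) x `<=` set_add (hmul y x) (hmul z x);
  hmulDr : forall x y z, hmul x (y + z) `<=` set_add (hmul x y) (hmul x z);
  hmulC : forall x y, hmul x y = hmul y x;
  hmul1 : forall a, hmul hone a a
}.

(* The identity is part of the structure; the axioms do not make it unique,
   and it may be zero. *)
#[short(type="comMultHyperringType")]
HB.structure Definition ComMultHyperring :=
  { G of Zmodule_isComMultHyperring G & GRing.Zmodule G }.

Notation "x *o y" := (hmul x y) (at level 40, left associativity).
Notation "X **o Y" := (lift_hop (@hmul _) X Y) (at level 40, left associativity).

Section Notions.
Variable G : comMultHyperringType.
Implicit Types (A P S : set G) (a x y r s t u v : G).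

(* a o b_1 o ... o b_k for s = [:: b_1; ...; b_k]: a product of k + 1 >= 1
   elements. *)
Definition hprod a (s : seq G) : set G :=
  foldl (fun X b => X **o [set b]) [set a] s.

Definition hyperideal A : Prop :=
  [/\ A !=set0,
      forall x y, A x -> A y -> A (x - y) &
      forall r x, A x -> r *o x `<=` A].

Definition prime_hyperideal P : Prop :=
  [/\ hyperideal P, P <> setT &
      forall x y, x *o y `<=` P -> P x \/ P y].

(* The intersection over the empty family is setT, so rad A is the whole
   hyperring when no prime hyperideal contains A. *)
Definition rad A : set G :=
  \bigcap_(P in [set P | prime_hyperideal P /\ A `<=` P]) P.

Definition C_hyperideal A : Prop :=
  hyperideal A /\
  forall a (s : seq G), hprod a s `&` A !=set0 -> hprod a s `<=` A.

Definition mult_closed_subset S : Prop :=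
  S hone /\ forall s1 s2, S s1 -> S s2 -> (s1 *o s2) `&` S !=set0.

Definition quasi_primary S A : Prop :=
  [/\ hyperideal A, A `&` S = set0 &
      exists2 t, S t & forall u v, u *o v `<=` A ->
        t *o u `<=` rad A \/ t *o v `<=` rad A].

End Notions.

Section Product.
Variables G1 G2 : comMultHyperringType.
Implicit Types x y z u v : (G1 * G2)%type.

Let pone : (G1 * G2)%type := (hone, hone).

Let pmul u v : set (G1 * G2) := (u.1 *o v.1) `*` (u.2 *o v.2).

Let pmul_neq0 x y : pmul x y !=set0.
Proof.
have [a xa] := hmul_neq0 x.1 y.1; have [b xb] := hmul_neq0 x.2 y.2.
by exists (a, b).
Qed.

Let pmulA x y z :
  lift_hop pmul (pmul x y) [set z] = lift_hop pmul [set x] (pmul y z).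
Proof.
have E1 := hmulA x.1 y.1 z.1; have E2 := hmulA x.2 y.2 z.2.
apply/seteqP; split=> -[a b].
- move=> [[c d] /= [/= Hc Hd] [_ -> [/= Ha Hb]]].
  have : lift_hop (@hmul _) (x.1 *o y.1) [set z.1] a.
    by exists c => //; exists z.1.
  have : lift_hop (@hmul _) (x.2 *o y.2) [set z.2] b.
    by exists d => //; exists z.2.
  rewrite E1 E2 => -[_ -> [q Hq Hq']] [_ -> [p Hp Hp']].
  by exists x => //; exists (p, q).
- move=> [_ -> [[c d] /= [/= Hc Hd] [/= Ha Hb]]].
  have : lift_hop (@hmul _) [set x.1] (y.1 *o z.1) a.
    by exists x.1 => //; exists c.
  have : lift_hop (@hmul _) [set x.2] (y.2 *o z.2) b.
    by exists x.2 => //; exists d.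
  rewrite -E1 -E2 => -[q Hq [_ -> Hq']] [p Hp [_ -> Hp']].
  by exists (p, q) => //; exists z.
Qed.

Let set_oppX (X : set G1) (Y : set G2) :
  set_opp X `*` set_opp Y = set_opp (X `*` Y).
Proof.
apply/seteqP; split=> -[a b] /=.
- by move=> [/= [c Xc <-] [d Yd <-]]; exists (c, d).
- by move=> [[c d] [/= Xc Yd] [<- <-]]; split; [exists c | exists d].
Qed.

Let pmulNl x y : pmul (- x) y = set_opp (pmul x y).
Proof. by rewrite /pmul -set_oppX -!hmulNl. Qed.

Let pmulNr x y : pmul x (- y) = set_opp (pmul x y).
Proof. by rewrite /pmul -set_oppX -!hmulNr. Qed.

Let pmulDl x y z : pmul (y + z) x `<=` set_add (pmul y x) (pmul z x).
Proof.
move=> [a b] [/= /hmulDl [c yc [d zd <-]] /hmulDl [c' yc' [d' zd' <-]]].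
by exists (c, c') => //; exists (d, d').
Qed.

Let pmulDr x y z : pmul x (y + z) `<=` set_add (pmul x y) (pmul x z).
Proof.
move=> [a b] [/= /hmulDr [c yc [d zd <-]] /hmulDr [c' yc' [d' zd' <-]]].
by exists (c, c') => //; exists (d, d').
Qed.

Let pmulC x y : pmul x y = pmul y x.
Proof. by rewrite /pmul (hmulC x.1) (hmulC x.2). Qed.

Let pmul1 x : pmul pone x x.
Proof. by split; apply: hmul1. Qed.

HB.instance Definition _ := Zmodule_isComMultHyperring.Build (G1 * G2)%type
  pmul_neq0 pmulA pmulNl pmulNr pmulDl pmulDr pmulC pmul1.

End Product.

(* Main.v *)
From Pilot Require Import Defs.
From mathcomp Require Import all_boot all_algebra.
From mathcomp Require Import unstable boolp classical_sets.
(* Imported again so that [rad] is the radical of a hyperideal and not the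
   radical of a sesquilinear form. *)
Import Pilot.Defs.

(** Two facts carry the proof.

    First, the radical of a product is the product of the radicals
    ([rad_setX]).  Every hyperideal contains [0], hence absorbs every
    [0 *o x].  A prime [P] of [G1 * G2] therefore contains
    [(1, 0) *o (0, 1) = (0 *o 1) `*` (0 *o 1) = 0 *o (1, 1)], hence
    [(1, 0)] or [(0, 1)], and so it is a cylinder over a prime of one factor
    ([prime_hyperideal_cylinder]); conversely cylinders over primes are prime.

    Second, a hyperideal whose radical meets a multiplicative closed subset [S]
    itself meets [S] ([rad_meets_mcs]): a hyperideal maximal among those that
    contain it and avoid [S] is prime.

    If the product is quasi primary with witness [(t1, t2)], then since
    [(1, 0) *o (0, 1)] lies in [A1 `*` A2], some [ti] lies in [rad Ai], and so
    [Ai] meets [Si] by the second fact.  The condition on the other factor is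
    read off from the products [(0, u) *o (1, v)].  Conversely, if [s] is in
    both [S1] and [A1] and [t] witnesses that [A2] is quasi primary, then
    [(s, t)] works for the product, because [s] annihilates the first
    coordinate modulo [A1].  The exchange of the two factors reduces each
    alternative to the other. *)

Set Implicit Arguments.
Unset Strict Implicit.
Unset Printing Implicit Defensive.

Import GRing.Theory.
Local Open Scope classical_set_scope.
Local Open Scope ring_scope.

(** * Hyperideals and their colons *)

Section Hyperideals.
Context {G : comMultHyperringType}.
Implicit Types (A P S : set G) (r s t x y z : G).

Lemma hyperideal0 A : hyperideal A -> A 0.
Proof. by case=> -[x Ax] AB _; rewrite -(subrr x); apply: AB. Qed.

(** [0 *o r] need not be [[set 0]], but no hyperideal can tell the
    difference. *)
Lemma hyperideal_mul0 A r : hyperideal A -> 0 *o r `<=` A.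
Proof.
by move=> hA; rewrite hmulC; case: (hA) => _ _; apply; exact: hyperideal0.
Qed.

Lemma hmul_one x : (x *o hone) x.
Proof. by rewrite hmulC; exact: hmul1. Qed.

Definition hcolon P x : set G := [set z | x *o z `<=` P].

Lemma hcolonC P x y : hcolon P x y <-> hcolon P y x.
Proof. by rewrite /hcolon /= hmulC. Qed.

Lemma subset_hcolon P x : hyperideal P -> P `<=` hcolon P x.
Proof. by case=> _ _ PM z; exact: PM. Qed.

(** The one-sided distributivity suffices here, because it bounds
    [x *o (y - z)] from above. *)
Lemma hyperideal_hcolon P x : hyperideal P -> hyperideal (hcolon P x).
Proof.
move=> hP; have [_ PB PM] := hP; split.
- by exists 0; apply: subset_hcolon => //; exact: hyperideal0.
- move=> y z xyP xzP _ /hmulDr[a xya [b + <-]].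
  by rewrite hmulNr => -[c xzc <-]; apply: PB; [exact: xyP | exact: xzP].
- move=> r z xzP w rzw p xwp.
  have : lift_hop (@hmul G) [set x] (z *o r) p.
    by exists x => //; exists w => //; rewrite hmulC.
  rewrite -hmulA => -[q xzq [_ -> ]]; rewrite hmulC; apply: PM.
  exact: xzP.
Qed.

(** * Maximal hyperideals avoiding a multiplicative closed subset *)

Definition avoiding A S : set (set G) :=
  [set P | [/\ hyperideal P, A `<=` P & P `&` S = set0]].

Lemma exists_maximal_avoiding A S : hyperideal A -> A `&` S = set0 ->
  exists2 P, avoiding A S P &
    forall Q, avoiding A S Q -> P `<=` Q -> Q `<=` P.
Proof.
move=> hA AS.
(* Joining A to every member makes the empty chain admissible. *)
pose adm X := avoiding A S (A `|` X).
have [|M [admM maxM]] := @Zorn_bigcup G adm.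
  move=> F Fadm Ftot.
  have chain x y : (A `|` \bigcup_(X in F) X) x ->
      (A `|` \bigcup_(X in F) X) y ->
      A `|` \bigcup_(X in F) X = A \/
      exists2 X, F X & (A `|` X) x /\ (A `|` X) y.
    case=> [Ax|[X FX Xx]]; case=> [Ay|[Y FY Yy]].
    - have [[X FX]|F0] := pselect (F !=set0).
        by right; exists X => //; split; left.
      left; apply/setUidPl => z [X FX]; case: F0; by exists X.
    - by right; exists Y => //; split; [left | right].
    - by right; exists X => //; split; [right | left].
    - have [XY|YX] := Ftot _ _ FX FY.
        by right; exists Y => //; split; right => //; exact: XY.
      by right; exists X => //; split; right => //; exact: YX.
  have sub X : F X -> A `|` X `<=` A `|` \bigcup_(X in F) X.
    by move=> FX z [|Xz]; [left | right; exists X].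
  split; last 2 first.
  - by left.
  - apply/seteqP; split=> // z [Az Sz].
    case: (chain _ _ Az Az) => [E|[X FX [Xz _]]].
      by rewrite E in Az; rewrite -AS.
    by have [_ _ <-] := Fadm _ FX.
  split.
  - by exists 0; left; exact: hyperideal0.
  - move=> x y Ax Ay; case: (chain _ _ Ax Ay) => [E|[X FX [Xx Xy]]].
      by rewrite E in Ax Ay *; case: hA => _ AB _; exact: AB.
    by apply: (sub X FX); have [[_ XB _] _ _] := Fadm _ FX; exact: XB.
  - move=> r x Ax; case: (chain _ _ Ax Ax) => [E|[X FX [Xx _]]].
      by rewrite E in Ax *; case: hA => _ _; exact.
    apply: subset_trans (sub X FX).
    by have [[_ _ XM] _ _] := Fadm _ FX; exact: XM.
exists (A `|` M) => // Q avQ MQ; have [_ AQ _] := avQ.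
apply: contrapT => nQM; apply: (maxM Q).
  by split=> [z Mz|QM]; [apply: MQ; right | apply: nQM => z /QM; right].
by rewrite /adm (_ : A `|` Q = Q) //; apply/setUidPr.
Qed.

(** Let [P] be maximal and [x *o y `<=` P] with neither factor in [P].  The
    colon of [P] by [x] strictly contains [P], so it meets [S] at some [s];
    then [x] is in the colon of [P] by [s], which likewise meets [S] at some
    [s'].  Hence [s *o s' `<=` P], although [s *o s'] meets [S]. *)
Lemma maximal_avoiding_prime A S P : mult_closed_subset S -> avoiding A S P ->
    (forall Q, avoiding A S Q -> P `<=` Q -> Q `<=` P) ->
  prime_hyperideal P.
Proof.
move=> [S1 SM] [hP AP PS] maxP.
have colon_meets x y : hcolon P x y -> ~ P y -> exists2 s, S s & hcolon P x s.
  move=> xyP nPy; apply: contrapT => nS; apply: nPy.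
  apply: (maxP (hcolon P x)) => //; last exact: subset_hcolon.
  split; first exact: hyperideal_hcolon.
    by apply: (subset_trans AP); exact: subset_hcolon.
  by apply/seteqP; split=> // s [xsP Ss]; apply: nS; exists s.
split=> //.
  by move=> PT; have : (P `&` S) hone by [rewrite PT]; rewrite PS.
move=> x y xyP; apply: contrapT => /not_orP[nPx nPy].
have [s Ss /hcolonC sxP] := colon_meets _ _ xyP nPy.
have [s' Ss' ssP] := colon_meets _ _ sxP nPx.
have [w [ssw Sw]] := SM _ _ Ss Ss'.
by have : (P `&` S) w by [split=> //; exact: ssP]; rewrite PS.
Qed.

(** If [A] avoided [S], then a prime containing [A] and avoiding [S] would
    exclude [t] from the radical. *)
Lemma rad_meets_mcs A S t : hyperideal A -> mult_closed_subset S ->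
  S t -> rad A t -> S `&` A !=set0.
Proof.
move=> hA hS St rAt; rewrite setIC; apply: contrapT => /nonemptyPn AS.
have [P avP maxP] := exists_maximal_avoiding hA AS.
have primeP := maximal_avoiding_prime hS avP maxP.
case: avP => _ AP PS.
by have : (P `&` S) t by [split=> //; exact: rAt]; rewrite PS.
Qed.

Lemma subset_rad A : A `<=` rad A.
Proof. by move=> x Ax P [_]; exact. Qed.

End Hyperideals.

(** * Exchanging the two factors *)

Section Swap.
Context {G1 G2 : comMultHyperringType}.
Implicit Types A P S : set (G1 * G2)%type.

Lemma hyperideal_swap A :
  hyperideal A -> hyperideal (swap @^-1` A : set (G2 * G1)%type).
Proof.
case=> -[[a b] Aab] AB AM; split.
- by exists (b, a).
- by move=> [x1 x2] [y1 y2]; exact: AB.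
- move=> [r1 r2] [x1 x2] Ax [w1 w2] [/= w1P w2P].
  by apply: (AM (r2, r1) (x2, x1)).
Qed.

Lemma hmul_swap_sub P (x y : (G2 * G1)%type) :
  x *o y `<=` swap @^-1` P <-> swap x *o swap y `<=` P.
Proof.
split=> xyP [w1 w2] [/= w1P w2P].
  by apply: (xyP (w2, w1)).
by apply: xyP.
Qed.

Lemma prime_hyperideal_swap P :
  prime_hyperideal P -> prime_hyperideal (swap @^-1` P : set (G2 * G1)%type).
Proof.
case=> hP PT PM; split; first exact: hyperideal_swap.
- move=> PT'; apply: PT; apply/seteqP; split=> // -[a b] _.
  by have : (swap @^-1` P : set (G2 * G1)%type) (b, a) by rewrite PT'.
- by move=> x y /hmul_swap_sub; exact: PM.
Qed.

End Swap.

Lemma rad_swap (G1 G2 : comMultHyperringType) (A : set (G1 * G2)%type) :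
  rad (swap @^-1` A : set (G2 * G1)%type) = swap @^-1` rad A.
Proof.
apply/seteqP; split=> -[b a] rAx P [primeP AP];
  apply: (rAx (swap @^-1` P)); split; try exact: prime_hyperideal_swap;
  by move=> [c d] Acd; apply: AP.
Qed.

Lemma quasi_primary_swap (G1 G2 : comMultHyperringType)
    (S1 A1 : set G1) (S2 A2 : set G2) :
  quasi_primary (S1 `*` S2 : set (G1 * G2)%type) (A1 `*` A2) ->
  quasi_primary (S2 `*` S1 : set (G2 * G1)%type) (A2 `*` A1).
Proof.
have swapX T1 T2 (B1 : set T1) (B2 : set T2) :
    B2 `*` B1 = swap @^-1` (B1 `*` B2).
  by apply/seteqP; split=> -[b a] [].
rewrite (swapX _ _ A1) (swapX _ _ S1) => -[hA AS [t St tM]]; split.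
- exact: hyperideal_swap.
- by rewrite -preimage_setI AS preimage_set0.
exists (swap t); first by case: t St {tM}.
move=> u v /hmul_swap_sub/tM; rewrite rad_swap.
by case=> tP; [left | right]; apply/hmul_swap_sub; case: t tP {St tM}.
Qed.

(** * The radical of a product *)

Section Product.
Context {G1 G2 : comMultHyperringType}.

Lemma hyperideal_setX (A1 : set G1) (A2 : set G2) :
  hyperideal A1 -> hyperideal A2 ->
  hyperideal (A1 `*` A2 : set (G1 * G2)%type).
Proof.
case=> -[a1 Aa1] AB1 AM1 [[a2 Aa2] AB2 AM2]; split.
- by exists (a1, a2).
- by move=> x y [? ?] [? ?]; split; [exact: AB1 | exact: AB2].
- move=> r x [x1 x2] w [w1 w2].
  by split; [exact: AM1 w1 | exact: AM2 w2].
Qed.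

Lemma hmul_setX_subl (u v : (G1 * G2)%type) (A1 : set G1) (A2 : set G2) :
  u *o v `<=` A1 `*` A2 -> u.1 *o v.1 `<=` A1.
Proof.
by move=> uvA a aP; have [b bP] := hmul_neq0 u.2 v.2; have [] := uvA (a, b).
Qed.

Lemma hmul_setX_subr (u v : (G1 * G2)%type) (A1 : set G1) (A2 : set G2) :
  u *o v `<=` A1 `*` A2 -> u.2 *o v.2 `<=` A2.
Proof.
by move=> uvA b bP; have [a aP] := hmul_neq0 u.1 v.1; have [] := uvA (a, b).
Qed.

Lemma hmul_setX_sub (u v : (G1 * G2)%type) (A1 : set G1) (A2 : set G2) :
  u.1 *o v.1 `<=` A1 -> u.2 *o v.2 `<=` A2 -> u *o v `<=` A1 `*` A2.
Proof. by move=> uv1 uv2 w [? ?]; split; [exact: uv1 | exact: uv2]. Qed.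

Lemma prime_hyperideal_setXT (P1 : set G1) : prime_hyperideal P1 ->
  prime_hyperideal (P1 `*` setT : set (G1 * G2)%type).
Proof.
case=> hP PT PM; split.
- apply: hyperideal_setX => //; split=> //; by exists 0.
- move=> PT'; apply: PT; apply/seteqP; split=> // a _.
  by have [] : (P1 `*` (setT : set G2)) (a, 0) by rewrite PT'.
- by move=> x y /hmul_setX_subl/PM[?|?]; [left | right].
Qed.

(** Since [0 *o 1] contains [0], membership of [(0, 1)] forces
    [(0, y) \in (0, 1) *o (1, y)] for every [y], so [P] absorbs changes of the
    second coordinate. *)
Lemma prime_hyperideal_section (P : set (G1 * G2)%type) :
  prime_hyperideal P -> P (0, hone) ->
  exists2 P1, prime_hyperideal P1 & P = P1 `*` setT.
Proof.
move=> [hP PT PM] P01; have [_ PB Pmul] := hP.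
have P0y y : P (0, y).
  apply: (Pmul (hone, y) _ P01); split; first exact: hmul1.
  exact: hmul_one.
have Pany x y z : P (x, y) -> P (x, z).
  move=> Pxy; have -> : (x, z) = (x, y) - (0, y - z).
    by congr pair; rewrite /= ?subr0 // opprB addrCA subrr addr0.
  exact: PB.
have PE : P = [set x | P (x, 0)] `*` setT.
  apply/seteqP; split=> -[a b] //=; first by move=> /Pany.
  by case=> /Pany.
exists [set x | P (x, 0)] => //; split.
- split.
  + by exists 0; exact: P0y.
  + by move=> x y Px Py; apply: (Pany _ (0 - 0)); exact: PB Px Py.
  + move=> r x Px w rxw; apply: (Pmul (r, hone) _ Px).
    by split=> //=; exact: hmul1.
- move=> PT'; apply: PT; apply/seteqP; split=> // -[a b] _.
  by apply: (Pany _ 0); have : [set x | P (x, 0)] a by rewrite PT'.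
- move=> x y xyP; apply: (PM (x, 0) (y, 0)) => -[a b].
  by case=> /xyP/Pany.
Qed.

End Product.

(** The product [(1, 0) *o (0, 1)] lies in [0 *o (1, 1)], hence in [P]; so
    [P] contains one of the two factors. *)
Lemma prime_hyperideal_cylinder (G1 G2 : comMultHyperringType)
    (P : set (G1 * G2)%type) : prime_hyperideal P ->
  (exists2 P1, prime_hyperideal P1 & P = P1 `*` setT) \/
  (exists2 P2, prime_hyperideal P2 & P = setT `*` P2).
Proof.
move=> primeP; have [hP _ PM] := primeP.
have : ((hone, 0) : (G1 * G2)%type) *o (0, hone) `<=` P.
  move=> w [/=]; rewrite hmulC => w1 w2.
  by apply: (@hyperideal_mul0 _ P (hone, hone)).
move=> /PM[P10|P01]; last by left; exact: prime_hyperideal_section.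
have [P2 primeP2 PE] :=
  prime_hyperideal_section (prime_hyperideal_swap primeP) P10.
right; exists P2 => //; apply/seteqP; split=> -[a b].
  move=> Pab; have : (swap @^-1` P : set (G2 * G1)%type) (b, a) by [].
  by rewrite PE => -[].
by case=> /= _ P2b; have : (P2 `*` (setT : set G1)) (b, a) by []; rewrite -PE.
Qed.

Lemma rad_setX_fst (G1 G2 : comMultHyperringType)
    (A1 : set G1) (A2 : set G2) x :
  rad (A1 `*` A2 : set (G1 * G2)%type) x -> rad A1 x.1.
Proof.
move=> rAx P [primeP AP].
have [] // := rAx (P `*` setT); split; first exact: prime_hyperideal_setXT.
by move=> y [/AP ? _].
Qed.

Lemma rad_setX (G1 G2 : comMultHyperringType) (A1 : set G1) (A2 : set G2) :
  hyperideal A1 -> hyperideal A2 ->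
  rad (A1 `*` A2 : set (G1 * G2)%type) = rad A1 `*` rad A2.
Proof.
move=> hA1 hA2; have A10 := hyperideal0 hA1; have A20 := hyperideal0 hA2.
apply/seteqP; split=> [[a b] rAab|[a b] [/= rAa rAb] P [primeP AP]].
  split; first exact: rad_setX_fst rAab.
  apply: (@rad_setX_fst _ _ A2 A1 (b, a)).
  have -> : A2 `*` A1 = swap @^-1` (A1 `*` A2).
    by apply/seteqP; split=> -[? ?] [].
  by rewrite rad_swap.
case: (prime_hyperideal_cylinder primeP) => -[Q primeQ PE].
  rewrite PE; split=> //=; apply: rAa; split=> // x Ax.
  by have : P (x, 0) by [apply: AP]; rewrite PE => -[].
rewrite PE; split=> //=; apply: rAb; split=> // x Ax.
by have : P (0, x) by [apply: AP]; rewrite PE => -[].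
Qed.

(** * Quasi primary hyperideals of a product *)

Section QuasiPrimaryProduct.
Context {G1 G2 : comMultHyperringType} {A1 S1 : set G1} {A2 S2 : set G2}.
Hypotheses (hA1 : hyperideal A1) (hA2 : hyperideal A2).
Let G := (G1 * G2)%type.

(** The products [(0, u) *o (1, v)] carry the condition over to [A2]: they lie
    in [A1 `*` A2] as soon as [u *o v] lies in [A2]. *)
Lemma quasi_primary_setX_snd : S1 `&` A1 !=set0 ->
  quasi_primary (S1 `*` S2 : set G) (A1 `*` A2) -> quasi_primary S2 A2.
Proof.
move=> [s [S1s A1s]] [_ AS [t [St1 St2] tM]]; split=> //.
  apply/seteqP; split=> // x [A2x S2x].
  by have : ((A1 `*` A2) `&` (S1 `*` S2)) (s, x) by []; rewrite AS.
exists t.2 => // u v uvA; rewrite rad_setX // in tM.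
have /tM : ((0, u) : G) *o (hone, v) `<=` A1 `*` A2.
  by apply: hmul_setX_sub => //=; exact: hyperideal_mul0.
by case=> /hmul_setX_subr; [left | right].
Qed.

Lemma quasi_primary_setX_of_snd : S1 `&` A1 !=set0 ->
  quasi_primary S2 A2 -> quasi_primary (S1 `*` S2 : set G) (A1 `*` A2).
Proof.
move=> [s [S1s A1s]] [_ AS [t St tM]]; split.
- exact: hyperideal_setX.
- apply/seteqP; split=> // x [[_ A2x] [_ S2x]].
  by have : (A2 `&` S2) x.2 by []; rewrite AS.
exists (s, t) => // u v /hmul_setX_subr/tM; rewrite rad_setX //.
have srad w : s *o w `<=` rad A1.
  apply: subset_trans (@subset_rad _ A1); rewrite hmulC.
  by case: hA1 => _ _; exact.
by case=> tP; [left | right]; exact: hmul_setX_sub.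
Qed.

Lemma quasi_primary_setX_meets :
  mult_closed_subset S1 -> mult_closed_subset S2 ->
  quasi_primary (S1 `*` S2 : set G) (A1 `*` A2) ->
  S1 `&` A1 !=set0 \/ S2 `&` A2 !=set0.
Proof.
move=> hS1 hS2 [_ _ [t [St1 St2]]]; rewrite rad_setX // => tM.
have /tM : ((hone, 0) : G) *o (0, hone) `<=` A1 `*` A2.
  apply: hmul_setX_sub => /=; last exact: hyperideal_mul0.
  by rewrite hmulC; exact: hyperideal_mul0.
case=> [/hmul_setX_subl|/hmul_setX_subr] /= trad; [left | right].
  by apply: (rad_meets_mcs hA1 hS1 St1); apply: trad; exact: hmul_one.
by apply: (rad_meets_mcs hA2 hS2 St2); apply: trad; exact: hmul_one.
Qed.

End QuasiPrimaryProduct.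

Theorem theorem2p17 (G1 G2 : comMultHyperringType)
    (hG1 : (hone : G1) <> 0) (hG2 : (hone : G2) <> 0)
    (A1 : set G1) (A2 : set G2)
    (hA1 : C_hyperideal A1) (hA2 : C_hyperideal A2)
    (S1 : set G1) (S2 : set G2)
    (hS1 : mult_closed_subset S1) (hS2 : mult_closed_subset S2) :
  quasi_primary (S1 `*` S2 : set (G1 * G2)%type) (A1 `*` A2) <->
  ((S1 `&` A1 !=set0 /\ quasi_primary S2 A2) \/
   (S2 `&` A2 !=set0 /\ quasi_primary S1 A1)).
Proof.
have [{}hA1 _] := hA1; have [{}hA2 _] := hA2; split.
- move=> qA.
  case: (quasi_primary_setX_meets hA1 hA2 hS1 hS2 qA) => SA; [left | right].
    by split=> //; exact: quasi_primary_setX_snd qA.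
  by split=> //; exact: quasi_primary_setX_snd (quasi_primary_swap qA).
- case=> -[SA qA]; first exact: quasi_primary_setX_of_snd.
  by apply: quasi_primary_swap; exact: quasi_primary_setX_of_snd.
Qed.
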